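(* Let $\mu$ be a classification problem with Bayes regressor $f^*$, $r^*_a:=f^*\sharp(\mu^X_a\times\{a\})$, and fix $q\in\mathcal Q_k$. For each $a\in[m]$ let $\gamma^*_a\in\Gamma(r^*_a,q)$ be an optimal coupling for the cost $c(s,y)=\|s-y\|_1$, and let $T^*_{a}:\Delta_k\to\mathcal Y$ be the randomized function induced by $\gamma^*_a$, i.e. with Markov kernel $K_a(s,B)=\gamma^*_a(B\mid s)$ (a regular conditional distribution of $\gamma^*_a$ given the first coordinate). Define the randomized classifier $\bar h(x,a)=T^*_a(f^*(x,a))$. Then $$\sum_{a\in[m]}\mathrm{Err}_a(\bar h)=\frac12\sum_{a\in[m]}W_1(r^*_a,q)\quad\text{and}\quad \mathbb P(\bar h(X,a)=y\mid A=a)=q(y)\ \ \forall a\in[m],\,y\in\mathcal Y;$$ in particular $\bar h$ satisfies demographic parity.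
   Context: Setup. $\mathcal X$ is a standard Borel space, $k\ge 2$, $\mathcal Y=\{e_1,\dots,e_k\}\subset\mathbb R^k$ is the set of standard basis vectors (one-hot labels), and $\mathcal A=[m]=\{1,\dots,m\}$. A classification problem is a probability distribution $\mu$ of a triple $(X,Y,A)$ on $\mathcal X\times\mathcal Y\times\mathcal A$ with $\mathbb P(A=a)>0$ for every $a$; $\mu_a$ is $\mu$ conditioned on $A=a$ and $\mu^X_a$ is the law of $X$ under $\mu_a$. A randomized function $f:\mathcal U\to\mathcal V$ is given by a Markov kernel $K$ with $\mathbb P(f(u)\in B)=K(u,B)$; its internal randomness is independent of $(X,Y,A)$. A (randomized) classifier is a randomized function $h:\mathcal X\times\mathcal A\to\mathcal Y$, and $\mathrm{Err}_a(h):=\mathbb P(h(X,a)\neq Y\mid A=a)$, over $\mu$ and the randomness of $h$. $h$ satisfies demographic parity (DP) if $\mathbb P(h(X,a)=y\mid A=a)=\mathbb P(h(X,a')=y\mid A=a')$ for all $y,a,a'$. $\Delta_k=\{x\in\mathbb R^k:x\ge0,\ \sum_i x_i=1\}$. The Bayes regressor is $f^*(x,a)=\mathbb E_\mu[Y\mid X=x,A=a]\in\Delta_k$, and $f^*\sharp(\mu^X_a\times\{a\})$ is the law of $f^*(X,a)$ for $X\sim\mu^X_a$. $\mathcal Q_k$ is the set of probability distributions supported on $\mathcal Y$. $\Gamma(p,q)$ is the set of couplings of $p$ and $q$, and $W_1(p,q)=\inf_{\gamma\in\Gamma(p,q)}\int\|s-s'\|_1\,d\gamma(s,s')$. *)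

(* Defs.v *)
From HB Require Import structures.
From mathcomp Require Import all_boot all_order all_algebra.
From mathcomp Require Import all_classical all_reals all_analysis.
Set Implicit Arguments. Unset Strict Implicit. Unset Printing Implicit Defensive.
Import Order.TTheory GRing.Theory Num.Theory.
Local Open Scope classical_set_scope.
Local Open Scope ring_scope.

Section defs.
Context {R : realType} {k : nat}.

Definition basis_vec (i : 'I_k) : k.-tuple R := [tuple ((i == j)%:R : R) | j < k].

Definition Ylab : set (k.-tuple R) := [set s | exists i : 'I_k, s = basis_vec i].

Definition simplex : set (k.-tuple R) :=
  [set s | (forall i : 'I_k, 0 <= tnth s i) /\ \sum_(i < k) tnth s i = 1].

Definition l1dist (s s' : k.-tuple R) : R := \sum_(i < k) `|tnth s i - tnth s' i|.

Definition is_coupling (p q : set (k.-tuple R) -> \bar R)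
    (g : probability (k.-tuple R * k.-tuple R)%type R) : Prop :=
  (forall S, measurable S -> g (S `*` setT) = p S) /\
  (forall S, measurable S -> g (setT `*` S) = q S).

Definition W1 (p q : set (k.-tuple R) -> \bar R) : \bar R :=
  ereal_inf [set (\int[g]_z (l1dist z.1 z.2)%:E)%E
            | g in [set g : probability (k.-tuple R * k.-tuple R)%type R | is_coupling p q g]].

Definition is_cond_kernel (p : set (k.-tuple R) -> \bar R)
    (g : probability (k.-tuple R * k.-tuple R)%type R)
    (K : R.-pker (k.-tuple R) ~> (k.-tuple R)) : Prop :=
  forall S B, measurable S -> measurable B ->
    g (S `*` B) = (\int[p]_(s in S) K s B)%E.

Context {d : measure_display} {T : measurableType d}.
(* a classification problem: law of (X, Y, A) on X x R^k x nat *)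
Notation Omega := ((T * k.-tuple R) * nat)%type.

Definition is_classification_problem (m : nat) (mu : probability Omega R) : Prop :=
  mu [set z | Ylab z.1.2] = 1%E /\
  mu [set z | (1 <= z.2 <= m)%N] = 1%E /\
  (forall a, (1 <= a <= m)%N -> (0 < mu [set z | z.2 = a])%E).

Definition condA (mu : probability Omega R) (a : nat) : set Omega -> \bar R :=
  fun E => (mu (E `&` [set z | z.2 = a]) * ((fine (mu [set z | z.2 = a]))^-1)%:E)%E.

Definition condX (mu : probability Omega R) (a : nat) : set T -> \bar R :=
  fun B => condA mu a [set z | B z.1.1].

(* f is (a version of) the Bayes regressor E[Y | X, A], valued in Delta_k *)
Definition is_bayes_regressor (mu : probability Omega R) (f : T * nat -> k.-tuple R) : Prop :=
  measurable_fun setT f /\ (forall xa, simplex (f xa)) /\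
  forall (E : set (T * nat)) (i : 'I_k), measurable E ->
    (\int[mu]_(z in [set z | E (z.1.1, z.2)]) (tnth z.1.2 i)%:E =
     \int[mu]_(z in [set z | E (z.1.1, z.2)]) (tnth (f (z.1.1, z.2)) i)%:E)%E.

(* a randomized classifier h : X x A -> Y, given by its Markov kernel
   H (x, a) = law of h(x, a) *)
Definition Err (mu : probability Omega R) (H : T * nat -> set (k.-tuple R) -> \bar R)
    (a : nat) : \bar R :=
  (\int[condA mu a]_z H (z.1.1, a) [set y | y <> z.1.2])%E.

Definition Ppred (mu : probability Omega R) (H : T * nat -> set (k.-tuple R) -> \bar R)
    (a : nat) (y : k.-tuple R) : \bar R :=
  (\int[condA mu a]_z H (z.1.1, a) [set y])%E.

Definition demographic_parity (m : nat) (mu : probability Omega R)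
    (H : T * nat -> set (k.-tuple R) -> \bar R) : Prop :=
  forall y a a', Ylab y -> (1 <= a <= m)%N -> (1 <= a' <= m)%N ->
    Ppred mu H a y = Ppred mu H a' y.

End defs.

(* Main.v *)
(* Given X and A = a, write S = f(X, a). The Bayes property says that, given S,
   the label is e_i with probability S_i, while hbar is drawn from K_a(S, .).
   Hence P(Y = e_i, hbar = e_j | A = a) is the integral of S_i K_a(S, {e_j}),
   which by disintegration is the integral of s_i 1_{y = e_j} under the coupling
   gamma_a. Summing over i <> j and using
   ||s - e_j||_1 = 2 sum_{i <> j} s_i on the simplex,
   2 Err_a is the transport cost of gamma_a, which is W_1 by optimality. *)
Require Import Defs.
From HB Require Import structures.
From mathcomp Require Import all_boot all_order all_algebra.
From mathcomp Require Import all_classical all_reals all_analysis measurable_realfun.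
Import Order.TTheory GRing.Theory Num.Theory.
Local Open Scope classical_set_scope.
Local Open Scope ring_scope.

(** * Integrals of a weight times a composite function *)

Section weighted_integral.
Local Open Scope ereal_scope.
Import HBNNSimple.

(** On the right, [m], [phi] and [w] enter only through the set function
    $E\mapsto\int_{\varphi^{-1}(E)}w\,dm$, so two such triples can be compared by comparing their
    set functions. *)
Lemma ge0_integral_weighted_approx (R : realType) d d' (T : measurableType d)
    (U : measurableType d') (m : {measure set T -> \bar R}) (phi : T -> U)
    (w : T -> \bar R) (g : U -> \bar R) (mg : measurable_fun [set: _] g) :
  measurable_fun [set: _] phi -> measurable_fun [set: _] w ->
  (forall x, 0 <= w x) -> (forall x, w x \is a fin_num) -> (forall y, 0 <= g y) ->
  \int[m]_x (w x * g (phi x)) =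
  limn (fun n => \sum_(r \in range (nnsfun_approx measurableT mg n))
    (r%:E * \int[m]_(x in phi @^-1` (nnsfun_approx measurableT mg n @^-1` [set r])) w x)).
Proof.
move=> mphi mw w0 wfin g0; set h := nnsfun_approx measurableT mg.
have mpre (A : set U) : measurable A -> measurable (phi @^-1` A).
  by move=> mA; rewrite -[X in measurable X]setTI; exact: mphi.
have mhphi n : measurable_fun [set: _] (fun x => (h n (phi x))%:E).
  by apply/measurable_EFinP; exact: (@measurableT_comp _ _ _ _ _ _ (h n)).
(* Monotone convergence: the simple functions [h n] increase to [g], and multiplying by $w\ge0$
   keeps the order. *)
transitivity (limn (fun n => \int[m]_x (w x * (h n (phi x))%:E))).
  rewrite -monotone_convergence//=.
  - apply: eq_integral => x _; apply/esym/cvg_lim => //.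
    by apply: cvgeZl => //; exact: (@cvg_nnsfun_approx _ _ _ _ measurableT _ mg).
  - by move=> n; exact: emeasurable_funM.
  - by move=> n x _; rewrite mule_ge0// lee_fin.
  - move=> x _ a b ab; rewrite lee_wpmul2l ?lee_fin//.
    exact/lefP/nd_nnsfun_approx.
apply: congr_lim; apply/funext => n.
have mind r : measurable_fun [set: _] (fun x => (\1_(phi @^-1` (h n @^-1` [set r])) x : R)%:E).
  by apply/measurable_EFinP/measurable_indic/mpre.
(* Split [h n] into its finitely many level sets. *)
transitivity (\int[m]_x (\sum_(r \in range (h n))
    (r%:E * (w x * (\1_(phi @^-1` (h n @^-1` [set r])) x)%:E)))).
  apply: eq_integral => x _.
  rewrite fimfunE -fsumEFin// ge0_mule_fsumr; last first.
    by move=> r; rewrite EFinM nnfun_muleindic_ge0.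
  by apply: eq_fsbigr => r _; rewrite EFinM muleCA.
rewrite ge0_integral_fsum//; last 2 first.
- by move=> r; apply: emeasurable_funM => //; exact: emeasurable_funM.
- move=> r x _; rewrite muleCA mule_ge0//.
  exact: (nnfun_muleindic_ge0 (h n) r (phi x)).
apply: eq_fsbigr => r; rewrite inE => -[y _ <-].
rewrite ge0_integralZl//.
- congr (_ * _); rewrite [RHS]integral_mkcond.
  by apply: eq_integral => x _; rewrite epatch_indic.
- exact: emeasurable_funM.
- by move=> x _; rewrite mule_ge0// lee_fin.
- by rewrite lee_fin.
Qed.

(** The hypothesis on [E] says that the measures $w_i\,dm_i$ have the same image under $\varphi_i$;
    both sides integrate [g] against that image. Applied below to both the Bayes property and the
    disintegration. *)
Lemma eq_integral_weighted_comp (R : realType) d1 d2 d' (T1 : measurableType d1)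
    (T2 : measurableType d2) (U : measurableType d')
    (m1 : {measure set T1 -> \bar R}) (m2 : {measure set T2 -> \bar R})
    (phi1 : T1 -> U) (phi2 : T2 -> U)
    (w1 : T1 -> \bar R) (w2 : T2 -> \bar R) (g : U -> \bar R) :
  measurable_fun [set: _] phi1 -> measurable_fun [set: _] phi2 ->
  measurable_fun [set: _] w1 -> measurable_fun [set: _] w2 ->
  (forall x, 0 <= w1 x) -> (forall x, 0 <= w2 x) ->
  (forall x, w1 x \is a fin_num) -> (forall x, w2 x \is a fin_num) ->
  measurable_fun [set: _] g -> (forall y, 0 <= g y) ->
  (forall E, measurable E ->
    \int[m1]_(x in phi1 @^-1` E) w1 x = \int[m2]_(x in phi2 @^-1` E) w2 x) ->
  \int[m1]_x (w1 x * g (phi1 x)) = \int[m2]_x (w2 x * g (phi2 x)).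
Proof.
move=> mphi1 mphi2 mw1 mw2 w10 w20 w1fin w2fin mg g0 w12.
rewrite !(@ge0_integral_weighted_approx _ _ _ _ _ _ _ _ _ mg)//.
by apply: congr_lim; apply/funext => n; apply: eq_fsbigr => r _; rewrite w12.
Qed.

End weighted_integral.

(** * Kernels precomposed with a measurable map *)

Section precomposed_kernel.
Context d d1 d2 (X' : measurableType d) (X : measurableType d1)
  (Y : measurableType d2) (R : realType).
Variables (K : R.-pker X ~> Y) (S : X' -> X) (mS : measurable_fun [set: _] S).

(* The phantom measurability argument lets the kernel structure be inferred. *)
Definition kprecomp of measurable_fun [set: X'] S :=
  fun x : X' => K (S x) : {measure set Y -> \bar R}.

Let measurable_kprecomp U : measurable U -> measurable_fun [set: _] (kprecomp mS ^~ U).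
Proof.
by move=> mU; exact: (measurableT_comp (measurable_kernel K U mU) mS).
Qed.

HB.instance Definition _ := isKernel.Build _ _ _ _ _ (kprecomp mS) measurable_kprecomp.

Let kprecomp_prob x : kprecomp mS x setT = 1%E.
Proof. exact: prob_kernel. Qed.

HB.instance Definition _ :=
  Kernel_isProbability.Build _ _ _ _ _ (kprecomp mS) kprecomp_prob.

(** Needed for the error event, where the set measured by the kernel varies with the point. Once [S]
    is absorbed into the kernel, this is measurability of sections under a finite kernel. *)
Lemma measurable_kernel_section (A : set (X' * Y)) : measurable A ->
  measurable_fun [set: _] (fun x => K (S x) [set y | A (x, y)]).
Proof.
move=> mA; rewrite [X in measurable_fun _ X](_ : _ = (fun x => kprecomp mS x (xsection A x))).
  by apply: measurable_fun_xsection_finite_kernel; rewrite inE.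
by apply/funext => x; congr (K _ _); apply/seteqP; split => y; rewrite /xsection /= inE.
Qed.

End precomposed_kernel.

(** * One-hot vectors, the simplex and the $\ell_1$ cost *)

Section one_hot.
Context {R : realType} {k : nat}.
Notation e := (@basis_vec R k).

Lemma tnth_basis_vec (i j : 'I_k) : tnth (e i) j = (i == j)%:R.
Proof. by rewrite /basis_vec tnth_mktuple. Qed.

Lemma basis_vec_inj : injective e.
Proof.
move=> i j /(congr1 (fun t => tnth t j)); rewrite !tnth_basis_vec eqxx.
by case: eqP => // _ /eqP; rewrite eq_sym oner_eq0.
Qed.

Lemma measurable_tuple_set1 (y : k.-tuple R) : measurable [set y].
Proof.
rewrite (_ : [set y] = \bigcap_(i in [set: 'I_k]) ((fun s : k.-tuple R => tnth s i) @^-1` [set tnth y i])).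
  apply: fin_bigcap_measurable => [|i _]; first exact: finite_finset.
  by rewrite -[X in measurable X]setTI; exact: measurable_tnth.
apply/seteqP; split => [s -> //|s H].
by apply: eq_from_tnth => i; exact: H.
Qed.

Lemma measurable_Ylab : measurable (@Ylab R k).
Proof.
rewrite (_ : Ylab = \bigcup_(i in [set: 'I_k]) [set e i]).
  by apply: fin_bigcup_measurable => // i _; exact: measurable_tuple_set1.
by apply/seteqP; split => s; [move=> [i ->]; exists i|move=> [i _ ->]; exists i].
Qed.

Lemma trivIset_basis_vec (D : set 'I_k) : trivIset D (fun i => [set e i]).
Proof. by move=> i j _ _ [s [/= -> /basis_vec_inj]]. Qed.

Lemma measurable_simplex : measurable (@simplex R k).
Proof.
rewrite (_ : simplex = (\bigcap_(i in [set: 'I_k]) ((fun s : k.-tuple R => tnth s i) @^-1` `[0, +oo[))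
   `&` ((fun s : k.-tuple R => \sum_(i < k) tnth s i) @^-1` [set 1])).
  apply: measurableI.
    apply: fin_bigcap_measurable => [|i _]; first exact: finite_finset.
    by rewrite -[X in measurable X]setTI; exact: measurable_tnth.
  rewrite -[X in measurable X]setTI.
  by apply: measurable_sum => // i; exact: measurable_tnth.
apply/seteqP; split => s.
  by move=> [s0 s1]; split=> // i _ /=; rewrite in_itv/= s0.
by move=> [s0 s1]; split=> // i; have := s0 i I; rewrite /= in_itv/= andbT.
Qed.

(** Coordinate [j] contributes $1-s_j$, which is again the sum of the other coordinates. The
    absolute values keep the right side nonnegative off the simplex too, as the integrals below
    require. *)
Lemma l1dist_simplex_basis_vec (s : k.-tuple R) (j : 'I_k) : simplex s ->
  l1dist s (e j) = 2 * \sum_(i < k | i != j) `|tnth s i|.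
Proof.
move=> [s0 s1]; have eqs : \sum_(i < k | i != j) `|tnth s i| = \sum_(i < k | i != j) tnth s i.
  by apply: eq_bigr => i _; rewrite ger0_norm.
rewrite /l1dist (bigD1 j)//= tnth_basis_vec eqxx mulr2n mulrDl mul1r; congr (_ + _).
  rewrite eqs; move: s1; rewrite (bigD1 j)//= => s1.
  rewrite distrC ger0_norm; first by rewrite -s1 addrAC subrr add0r.
  by rewrite subr_ge0 -s1 lerDl sumr_ge0.
by apply: eq_bigr => i ij; rewrite tnth_basis_vec eq_sym (negbTE ij) subr0.
Qed.

Lemma measurable_l1dist :
  measurable_fun [set: k.-tuple R * k.-tuple R] (fun z => l1dist z.1 z.2).
Proof.
apply: measurable_sum => i; apply: measurableT_comp => //.
apply: measurable_funB.
  exact: (measurableT_comp (measurable_tnth i)).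
exact: (measurableT_comp (measurable_tnth i)).
Qed.

Lemma l1dist_ge0 (s s' : k.-tuple R) : 0 <= l1dist s s'.
Proof. by apply: sumr_ge0. Qed.

(** Up to a null set, the event is the disjoint union of the singletons $\{e_j\}$ with $j\ne i$. *)
Lemma measure_neq_basis_vec (nu : {measure set (k.-tuple R) -> \bar R}) (i : 'I_k) :
  nu (~` Ylab) = 0%E ->
  nu [set y | y <> e i] = (\sum_(j < k | j != i) nu [set e j])%E.
Proof.
move=> nu0; have mN : measurable [set y | y <> e i].
  exact: (measurableC (measurable_tuple_set1 (e i))).
rewrite (measureDI nu mN measurable_Ylab).
rewrite (@subset_measure0 _ _ _ _ _ (~` Ylab)) ?add0e//; last 2 first.
- exact: (measurableD mN measurable_Ylab).
- exact: (measurableC measurable_Ylab).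
rewrite -measure_bigsetU_ord_cond; last 2 first.
- by move=> j _; exact: measurable_tuple_set1.
- exact: trivIset_basis_vec.
congr (nu _); rewrite -bigcup_seq_cond; apply/seteqP; split => y.
  by move=> [yi [j yj]]; exists j => //=; rewrite mem_index_enum; apply/eqP => ji; apply: yi; rewrite yj ji.
move=> [j /= /andP[_ ji] ->]; split; last by exists j.
by move/basis_vec_inj => /eqP; apply/negP.
Qed.

End one_hot.

(** * Classification error as a transport cost *)

Lemma ge0_integral_sum_cond (R : realType) d (T : measurableType d)
    (m : {measure set T -> \bar R}) (I : Type) (r : seq I) (p : pred I)
    (f : I -> T -> \bar R) :
  (forall i, measurable_fun [set: T] (f i)) -> (forall i x, 0 <= f i x)%E ->
  (\int[m]_x (\sum_(i <- r | p i) f i x) = \sum_(i <- r | p i) \int[m]_x f i x)%E.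
Proof.
move=> mf f0; rewrite -[RHS]big_filter -ge0_integral_sum//.
by apply: eq_integral => x _; rewrite big_filter.
Qed.

Section coupling_error.
Local Open Scope ereal_scope.
Context {R : realType} {k : nat} {d : measure_display} {W : measurableType d}.
Notation vec := (k.-tuple R).
(** Abstract form of one group: [P] stands for the law given $A=a$, [Y] for the label, [S] for
    $f^*(X,a)$, [g] for the coupling $\gamma^*_a$ and [K] for its conditional kernel. *)
Variables (P : {measure set W -> \bar R}) (Y S : W -> vec).
Variables (K : R.-pker vec ~> vec) (g : {measure set (vec * vec) -> \bar R}).
Hypothesis mY : measurable_fun [set: W] Y.
Hypothesis mS : measurable_fun [set: W] S.
Hypothesis S_simplex : forall z, simplex (S z).
Hypothesis Y_onehot : P (Y @^-1` (~` Ylab)) = 0.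
Hypothesis Bayes : forall E (i : 'I_k), measurable E ->
  P (S @^-1` E `&` Y @^-1` [set basis_vec i]) =
  \int[P]_(z in S @^-1` E) (tnth (S z) i)%:E.
Hypothesis disint : forall E B, measurable E -> measurable B ->
  g (E `*` B) = \int[P]_(z in S @^-1` E) K (S z) B.
Hypothesis g_onehot : g ([set: vec] `*` (~` Ylab)) = 0.

Let fin_K s B : measurable B -> K s B \is a fin_num.
Proof.
move=> mB; rewrite ge0_fin_numE// (le_lt_trans _ (ltry 1))//.
by rewrite -(@prob_kernel _ _ _ _ _ K s) le_measure// inE.
Qed.

Let mpreS E : measurable E -> measurable (S @^-1` E).
Proof. by move=> mE; rewrite -[X in measurable X]setTI; exact: mS. Qed.

Let mpreY E : measurable E -> measurable (Y @^-1` E).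
Proof. by move=> mE; rewrite -[X in measurable X]setTI; exact: mY. Qed.

Let mpre2 E : measurable E -> measurable (@snd vec vec @^-1` E).
Proof. by move=> mE; rewrite -[X in measurable X]setTI; exact: measurable_snd. Qed.

Let mKS B : measurable B -> measurable_fun [set: W] (fun z => K (S z) B).
Proof. by move=> mB; exact: (measurableT_comp (measurable_kernel K B mB) mS). Qed.

Let mtnth (i : 'I_k) : measurable_fun [set: vec] (fun s => `|tnth s i|%:E).
Proof.
by apply/measurable_EFinP; apply: measurableT_comp => //; exact: measurable_tnth.
Qed.

(** The left side is the probability of label $e_i$ and prediction $e_j$. It is carried to the
    coupling by two changes of weight, one by the Bayes property and one by disintegration. *)
Let integral_label (i j : 'I_k) :
  \int[P]_z ((\1_(Y @^-1` [set basis_vec i]) z)%:E * K (S z) [set basis_vec j]) =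
  \int[g]_z ((\1_(snd @^-1` [set basis_vec j]) z)%:E * `|tnth z.1 i|%:E).
Proof.
have m1 (j' : 'I_k) : measurable [set (basis_vec j' : vec)] by exact: measurable_tuple_set1.
(* By [Bayes], the indicator of $Y=e_i$ and the weight $S_i$ have equal integrals over every event
   $S\in E$. *)
transitivity (\int[P]_z ((tnth (S z) i)%:E * K (S z) [set basis_vec j])).
  apply: (@eq_integral_weighted_comp _ _ _ _ _ _ _ _ _ _ _ _ _ (K ^~ [set basis_vec j])) => //.
  - by apply/measurable_EFinP/measurable_indic/mpreY.
  - apply/measurable_EFinP; exact: (measurableT_comp (measurable_tnth i)).
  - by move=> z; rewrite lee_fin (S_simplex z).1.
  - exact: measurable_kernel.
  - move=> E mE; rewrite -Bayes// integral_indic//; first by rewrite setIC.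
    + exact: mpreS.
    + exact: mpreY.
(* The roles are exchanged: the kernel becomes the weight and $|s_i|$ the integrated function, with
   an absolute value so that it is nonnegative on the whole space. *)
transitivity (\int[P]_z (K (S z) [set basis_vec j] * `|tnth (S z) i|%:E)).
  by apply: eq_integral => z _; rewrite muleC ger0_norm ?(S_simplex z).1.
(* By [disint], the weight $K(S,\{e_j\})$ under [P] matches the indicator that the second coordinate
   is $e_j$ under [g]. *)
apply: (@eq_integral_weighted_comp _ _ _ _ _ _ _ P g S fst
  (fun z => K (S z) [set basis_vec j]) _ (fun s => `|tnth s i|%:E)) => //.
- exact: mKS.
- by apply/measurable_EFinP/measurable_indic; exact: mpre2.
- by move=> z; exact: fin_K.
- move=> E mE; rewrite -disint// integral_indic//.
  + by congr (g _); apply/seteqP; split => -[a b] [].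
  + by rewrite -[X in measurable X]setTI; exact: measurable_fst.
  + exact: mpre2.
Qed.

(** Disintegrating [g_onehot] over the whole space gives a nonnegative function with integral
    zero. *)
Let K_onehot : {ae P, forall z, K (S z) (~` Ylab) = 0}.
Proof.
have mN : measurable (~` (@Ylab R k)) by exact: (measurableC measurable_Ylab).
have := disint _ _ measurableT mN; rewrite g_onehot => /esym.
rewrite preimage_setT => K0.
have : \int[P]_z `|K (S z) (~` Ylab)| = 0.
  by rewrite -[RHS]K0; apply: eq_integral => z _; rewrite gee0_abs.
move/(ae_eq_integral_abs P measurableT (mKS _ mN)).1.
by apply: filterS => z /(_ Logic.I).
Qed.

Lemma coupling_error :
  2%:E * \int[P]_z K (S z) [set y | y <> Y z] = \int[g]_z (l1dist z.1 z.2)%:E.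
Proof.
have m1 (j : 'I_k) : measurable [set (basis_vec j : vec)] by exact: measurable_tuple_set1.
have mindY i : measurable_fun [set: W] (fun z => (\1_(Y @^-1` [set (basis_vec i : vec)]) z : R)%:E).
  by apply/measurable_EFinP/measurable_indic; exact: mpreY.
have mindg j : measurable_fun [set: vec * vec]
    (fun z => (\1_(snd @^-1` [set (basis_vec j : vec)]) z : R)%:E).
  by apply/measurable_EFinP/measurable_indic; exact: mpre2.
have mfst i : measurable_fun [set: vec * vec] (fun z => `|tnth z.1 i|%:E).
  exact: (measurableT_comp (mtnth i)).
(* Split the error by true label $e_i$ and predicted label $e_j$, $j\ne i$. *)
have -> : \int[P]_z K (S z) [set y | y <> Y z] =
    \sum_(i < k) \sum_(j < k | j != i)
    \int[P]_z ((\1_(Y @^-1` [set basis_vec i]) z)%:E * K (S z) [set basis_vec j]).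
  pose F (i j : 'I_k) (z : W) := (\1_(Y @^-1` [set (basis_vec i : vec)]) z)%:E * K (S z) [set basis_vec j].
  have F0 i j z : 0 <= F i j z by rewrite mule_ge0// lee_fin.
  have mF i j : measurable_fun [set: W] (F i j).
    by apply: emeasurable_funM => //; exact: mKS.
  have mFs i : measurable_fun [set: W] (fun z => \sum_(j < k | j != i) F i j z).
    by under eq_fun do rewrite -big_filter; exact: emeasurable_sum.
  transitivity (\int[P]_z \sum_(i < k) \sum_(j < k | j != i) F i j z); last first.
    rewrite ge0_integral_sum_cond//; last by move=> i z; exact: sume_ge0.
    by apply: eq_bigr => i _; rewrite ge0_integral_sum_cond.
  apply: ge0_ae_eq_integral => //.
  (* The disagreement set is measurable because agreement means that finitely many coordinate
     differences vanish. *)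
  - have mD : measurable [set z : W * vec | z.2 <> Y z.1].
      rewrite (_ : [set _ | _] = ~` \bigcap_(i in [set: 'I_k])
          ((fun z : W * vec => (tnth z.2 i - tnth (Y z.1) i)%R) @^-1` [set 0%R])).
        apply/measurableC/fin_bigcap_measurable => [|i _]; first exact: finite_finset.
        rewrite -[X in measurable X]setTI.
        apply: measurable_funB => //.
          exact: (measurableT_comp (measurable_tnth i)).
        exact: (measurableT_comp (measurableT_comp (measurable_tnth i) mY)).
      apply/seteqP; split => -[z y] /= yz.
        move=> H; apply: yz; apply: eq_from_tnth => i.
        by apply/eqP; rewrite -subr_eq0; apply/eqP; exact: (H i I).
      by move=> E; apply: yz => i _; rewrite /= E subrr.
    exact: (@measurable_kernel_section _ _ _ _ _ _ _ K S mS _ mD).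
  - exact: emeasurable_sum.
  - by move=> z _; apply: sume_ge0 => i _; exact: sume_ge0.
  - have YY : {ae P, forall z, Ylab (Y z)}.
      by exists (Y @^-1` (~` Ylab)); split => //; exact: (mpreY _ (measurableC measurable_Ylab)).
    near=> z; move=> _.
    have KY : K (S z) (~` Ylab) = 0 by near: z; exact: K_onehot.
    have [i Yi] : Ylab (Y z) by near: z.
    (* Only the true label's outer summand survives. *)
    rewrite Yi measure_neq_basis_vec// [RHS](bigD1 i)//= [X in _ + X]big1 ?adde0.
      by apply: eq_bigr => j _; rewrite /F indicE mem_set ?mul1e.
    move=> i' i'i; apply: big1 => j _; rewrite /F indicE memNset ?mul0e//.
    rewrite /= Yi => /basis_vec_inj ii'; rewrite -ii' eqxx in i'i; exact: (negP i'i).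
(* Make the predicted label the outer index, as in the expansion of the cost. *)
rewrite (exchange_big_dep xpredT)//=.
have -> : \int[g]_z (l1dist z.1 z.2)%:E =
    \sum_(j < k) \sum_(i < k | i != j)
    (2%:E * \int[g]_z ((\1_(snd @^-1` [set basis_vec j]) z)%:E * `|tnth z.1 i|%:E)).
  pose F (i j : 'I_k) (z : vec * vec) := (\1_(snd @^-1` [set (basis_vec j : vec)]) z)%:E * `|tnth z.1 i|%:E : \bar R.
  have F0 i j z : 0 <= F i j z by rewrite mule_ge0// lee_fin.
  have mF i j : measurable_fun [set: vec * vec] (F i j).
    exact: emeasurable_funM.
  have mF2 i j : measurable_fun [set: vec * vec] (fun z => 2%:E * F i j z).
    exact: emeasurable_funM.
  have F20 i j z : 0 <= 2%:E * F i j z by rewrite mule_ge0.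
  have mFs j : measurable_fun [set: vec * vec] (fun z => \sum_(i < k | i != j) (2%:E * F i j z)).
    by under eq_fun do rewrite -big_filter; exact: emeasurable_sum.
  transitivity (\int[g]_z \sum_(j < k) \sum_(i < k | i != j) (2%:E * F i j z)); last first.
    rewrite ge0_integral_sum_cond//; last by move=> j z; exact: sume_ge0.
    apply: eq_bigr => j _; rewrite ge0_integral_sum_cond//.
    by apply: eq_bigr => i _; rewrite ge0_integralZl.
  apply: ge0_ae_eq_integral => //.
  - apply/measurable_EFinP; exact: measurable_l1dist.
  - exact: emeasurable_sum.
  - by move=> z _; rewrite lee_fin l1dist_ge0.
  - by move=> z _; apply: sume_ge0 => i _; exact: sume_ge0.
  - have g2 : {ae g, forall z, Ylab z.2}.
      exists (setT `*` (~` Ylab)); split => //.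
        exact: (measurableX measurableT (measurableC measurable_Ylab)).
    have mNs := measurableC (@measurable_simplex R k).
    (* Since [S] takes values in the simplex, disintegration gives mass zero to first coordinates
       outside it. *)
    have g1 : {ae g, forall z, simplex z.1}.
      exists ((~` simplex) `*` setT); split => //.
      - exact: (measurableX mNs measurableT).
      - rewrite disint// (_ : S @^-1` _ = set0) ?integral_set0//.
        by apply/seteqP; split => z //=.
    near=> z; move=> _.
    have s1 : simplex z.1 by near: z.
    have [j zj] : Ylab z.2 by near: z.
    rewrite zj l1dist_simplex_basis_vec// [RHS](bigD1 j)//= [X in _ + X]big1 ?adde0.
      rewrite EFinM -sumEFin ge0_sume_distrr//.
      by apply: eq_bigr => i _; rewrite /F indicE mem_set ?mul1e.
    move=> j' j'j; apply: big1 => i _; rewrite /F indicE memNset ?mul0e ?mule0//.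
    rewrite /= zj => /basis_vec_inj jj'; rewrite -jj' eqxx in j'j; exact: (negP j'j).
rewrite ge0_sume_distrr.
  apply: eq_bigr => j _; rewrite ge0_sume_distrr.
    by apply: eq_big => i; [rewrite eq_sym|rewrite integral_label].
  by move=> i _; apply: integral_ge0 => z _; rewrite mule_ge0// lee_fin.
move=> j _; apply: sume_ge0 => i _.
by apply: integral_ge0 => z _; rewrite mule_ge0// lee_fin.
Unshelve. all: by end_near.
Qed.

End coupling_error.

(** * Restriction of measures and conditioning on $A=a$ *)

Lemma ge0_integral_mrestr (R : realType) d (T : measurableType d)
    (m : {measure set T -> \bar R}) (D A : set T) (mD : measurable D) (f : T -> \bar R) :
  measurable A -> measurable_fun [set: T] f -> (forall x, 0 <= f x)%E ->
  (\int[mrestr m mD]_(x in A) f x = \int[m]_(x in A `&` D) f x)%E.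
Proof.
move=> mA mf f0; rewrite [LHS]integral_mkcond [RHS]integral_mkcondr [RHS]integral_mkcond.
have f0A x : (0 <= (f \_ A) x)%E by exact: erestrict_ge0.
have mfA : measurable_fun [set: T] (f \_ A).
  by apply/(measurable_restrictT _ mA).1; exact: measurable_funTS.
transitivity (\int[mrestr m mD]_x (cst 1 x * (f \_ A) (id x)))%E.
  by apply: eq_integral => x _; rewrite mul1e.
(* With the identity as map, weight $1$ for the restricted measure corresponds to weight $1_D$ for
   [m]. *)
rewrite (@eq_integral_weighted_comp _ _ _ _ _ _ _ _ m id id (cst 1%E)
  (fun x => (\1_D x)%:E) (f \_ A))//.
- apply: eq_integral => x _; rewrite muleC.
  rewrite !patchE indicE; case: (x \in A); case: (x \in D);
    by rewrite ?(mule0, mul0e, mule1).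
- exact/measurable_EFinP/measurable_indic.
- move=> E mE; rewrite integral_cst// mul1e integral_indic//.
  by rewrite /mrestr /= setIC.
Qed.

Section conditioning.
Local Open Scope ereal_scope.
Context {R : realType} {k : nat} {d : measure_display} {T : measurableType d}.
Notation vec := (k.-tuple R).
Notation Omega := ((T * vec) * nat)%type.
Variables (mu : probability Omega R) (a : nat).

Let measurable_A : measurable [set z : Omega | z.2 = a].
Proof.
rewrite (_ : [set _ | _] = snd @^-1` [set a])//.
by rewrite -[X in measurable X]setTI; exact: measurable_snd.
Qed.

Let inv_prob_ge0 : (0 <= (fine (mu [set z | z.2 = a]))^-1)%R.
Proof. by rewrite invr_ge0 fine_ge0. Qed.

(** [condA] is a bare set function; building it by restriction and scaling supplies the measure
    structure used by the integration lemmas. *)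
Definition mcondA : {measure set Omega -> \bar R} :=
  mscale (NngNum inv_prob_ge0) (mrestr mu measurable_A).

Lemma condAE : condA mu a = mcondA.
Proof. by apply/funext => E; rewrite /condA /mcondA /= /mscale /= /mrestr muleC. Qed.

Lemma integral_mcondA (A : set Omega) (f : Omega -> \bar R) :
  measurable A -> measurable_fun [set: Omega] f -> (forall z, 0 <= f z) ->
  \int[mcondA]_(z in A) f z =
  ((fine (mu [set z | z.2 = a]))^-1)%:E * \int[mu]_(z in A `&` [set z | z.2 = a]) f z.
Proof.
move=> mA mf f0; rewrite /mcondA ge0_integral_mscale//; last exact: measurable_funTS.
by rewrite ge0_integral_mrestr.
Qed.

Lemma mcondA_null (N : set Omega) : measurable N -> mu N = 0 -> mcondA N = 0.
Proof.
move=> mN N0; rewrite /mcondA /= /mscale /= /mrestr.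
rewrite (@subset_measure0 _ _ _ _ (N `&` [set z | z.2 = a]) N) ?mule0//.
exact: measurableI.
Qed.

(** Both sides carry the same normalising factor; what remains is the defining property of [f] on a
    suitable test set, as coordinate [i] of a one-hot label is the indicator of $e_i$. *)
Lemma mcondA_Bayes (f : T * nat -> vec) (E : set vec) (i : 'I_k) :
  mu [set z | Ylab z.1.2] = 1 -> is_bayes_regressor mu f -> measurable E ->
  mcondA ([set z | E (f (z.1.1, a))] `&` [set z | z.1.2 = basis_vec i]) =
  \int[mcondA]_(z in [set z | E (f (z.1.1, a))]) (tnth (f (z.1.1, a)) i)%:E.
Proof.
move=> muY [mf [fs fB]] mE.
have mX : measurable_fun [set: Omega] (fun z => z.1.1).
  exact: (measurableT_comp measurable_fst measurable_fst).
have mS : measurable_fun [set: Omega] (fun z => f (z.1.1, a)).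
  by apply: (measurableT_comp mf); exact: measurable_fun_pair.
have mSi : measurable_fun [set: Omega] (fun z => (tnth (f (z.1.1, a)) i)%:E).
  by apply/measurable_EFinP; exact: (measurableT_comp (measurable_tnth i)).
have mY : measurable_fun [set: Omega] (fun z => z.1.2).
  exact: (measurableT_comp measurable_snd measurable_fst).
have mSE : measurable [set z : Omega | E (f (z.1.1, a))].
  by rewrite -[X in measurable X]setTI; exact: mS.
have mYi : measurable [set z : Omega | z.1.2 = basis_vec i].
  rewrite -[X in measurable X]setTI; exact: (mY _ _ (measurable_tuple_set1 (basis_vec i))).
rewrite integral_mcondA//; last by move=> z; rewrite lee_fin (fs _).1.
rewrite /mcondA /= /mscale/=; congr (_ * _); rewrite /mrestr.
(* The test set lies in the slice of group [a], where $f(x,b)=f(x,a)$. *)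
pose E' := [set xb : T * nat | E (f (xb.1, a)) /\ xb.2 = a].
have mE' : measurable E'.
  rewrite (_ : E' = ((fun xb => f (xb.1, a)) @^-1` E) `&` snd @^-1` [set a])//.
  apply: measurableI; rewrite -[X in measurable X]setTI.
    apply: (measurableT_comp mf) => //.
    apply: measurable_fun_pair => //; exact: measurable_fst.
  exact: measurable_snd.
have preE' : [set z : Omega | E' (z.1.1, z.2)] =
    [set z | E (f (z.1.1, a))] `&` [set z | z.2 = a] by [].
have := fB E' i mE'; rewrite preE' => fBi.
transitivity (\int[mu]_(z in [set z | E (f (z.1.1, a))] `&` [set z | z.2 = a])
    (tnth z.1.2 i)%:E); last first.
  by rewrite fBi; apply: eq_integral => z; rewrite inE => -[_ /= ->].
have mD := measurableI _ _ mSE measurable_A.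
transitivity (\int[mu]_(z in [set z | E (f (z.1.1, a))] `&` [set z | z.2 = a])
    (\1_[set z : Omega | z.1.2 = basis_vec i] z)%:E).
  by rewrite integral_indic// setIA [X in _ = mu (X `&` _)]setIC.
apply: ae_eq_integral => //.
- exact/measurable_funTS/measurable_EFinP/measurable_indic.
- apply: measurable_funTS; apply/measurable_EFinP.
  exact: (measurableT_comp (measurable_tnth i) mY).
- have mL : measurable [set z : Omega | Ylab z.1.2].
    rewrite -[X in measurable X]setTI; exact: (mY _ _ measurable_Ylab).
  have YY : {ae mu, forall z, Ylab z.1.2}.
    exists (~` [set z : Omega | Ylab z.1.2]); split => //; first exact: measurableC.
    by rewrite probability_setC// muY subee.
  near=> z; move=> _.
  have [j zj] : Ylab z.1.2 by near: z.
  rewrite zj tnth_basis_vec indicE; have [ji|/eqP ji] := eqVneq j i.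
    by rewrite mem_set//= zj ji.
  by rewrite memNset//= zj => /basis_vec_inj.
Unshelve. all: by end_near.
Qed.

End conditioning.

(** * Error identity and demographic parity of the induced classifier *)

Theorem theorem3p3 (R : realType) (k m : nat) (d : measure_display) (T : measurableType d)
    (mu : probability ((T * k.-tuple R) * nat)%type R)
    (f : (T * nat)%type -> k.-tuple R)
    (q : probability (k.-tuple R) R)
    (gam : nat -> probability (k.-tuple R * k.-tuple R)%type R)
    (K : nat -> R.-pker (k.-tuple R) ~> (k.-tuple R)) :
  (2 <= k)%N ->
  is_classification_problem m mu ->
  is_bayes_regressor mu f ->
  q (@Ylab R k) = 1%E ->
  let r := fun a => pushforward (condX mu a) (fun x => f (x, a)) in
  (forall a, (1 <= a <= m)%N ->
     is_coupling (r a) q (gam a) /\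
     (\int[gam a]_z (l1dist z.1 z.2)%:E)%E = W1 (r a) q) ->
  (forall a, (1 <= a <= m)%N -> is_cond_kernel (r a) (gam a) (K a)) ->
  let hbar := fun xa : (T * nat)%type => K xa.2 (f xa) in
  (\sum_(1 <= a < m.+1) Err mu hbar a = 2^-1%:E * \sum_(1 <= a < m.+1) W1 (r a) q)%E /\
  (forall a y, (1 <= a <= m)%N -> Ylab y -> Ppred mu hbar a y = q [set y]) /\
  demographic_parity m mu hbar.
Proof.
move=> _ [muY _] fBayes qY r gam_opt gamK hbar.
have [mf [fs _]] := fBayes.
have mS a : measurable_fun [set: (T * k.-tuple R) * nat] (fun z => f (z.1.1, a)).
  apply: (measurableT_comp mf); apply: measurable_fun_pair => //.
  exact: (measurableT_comp measurable_fst measurable_fst).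
have mY : measurable_fun [set: (T * k.-tuple R) * nat] (fun z => z.1.2).
  exact: (measurableT_comp measurable_snd measurable_fst).
(* Change of variables moves the disintegration from $r^*_a$ to the conditional law on the original
   space. *)
have disint a E B : (1 <= a <= m)%N -> measurable E -> measurable B ->
    gam a (E `*` B) =
    (\int[mcondA mu a]_(z in (fun z => f (z.1.1, a)) @^-1` E) K a (f (z.1.1, a)) B)%E.
  move=> am mE mB; rewrite (gamK a am E B mE mB).
  have -> : r a = pushforward (mcondA mu a) (fun z => f (z.1.1, a)).
    by rewrite -condAE.
  rewrite ge0_integral_pushforward//.
  by apply: measurable_funTS; exact: measurable_kernel.
(* Taking the whole space as first factor turns the disintegration into the second marginal [q]. *)
have PredE a y : (1 <= a <= m)%N -> Ppred mu hbar a y = q [set y].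
  move=> am; have my := measurable_tuple_set1 y.
  have [[_ gq] _] := gam_opt a am.
  by rewrite /Ppred condAE -(gq _ my) (disint a _ _ am measurableT my) preimage_setT.
have ErrE a : (1 <= a <= m)%N -> (Err mu hbar a = 2^-1%:E * W1 (r a) q)%E.
  move=> am; have [[_ gq] <-] := gam_opt a am.
  have mN := measurableC (@measurable_Ylab R k).
  rewrite /Err condAE.
  rewrite -(@coupling_error _ _ _ _ (mcondA mu a) (fun z => z.1.2)
    (fun z => f (z.1.1, a)) (K a) (gam a))//.
  - by rewrite muleA -EFinM mulVf// mul1e.
  - have mL : measurable [set z : (T * k.-tuple R) * nat | Ylab z.1.2].
      rewrite -[X in measurable X]setTI; exact: (mY _ _ (@measurable_Ylab R k)).
    apply: mcondA_null; first exact: (measurableC mL).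
    by rewrite probability_setC// muY subee.
  - by move=> E i mE; exact: mcondA_Bayes.
  - by move=> E B mE mB; exact: disint.
  - by apply: (etrans (gq _ mN)); rewrite probability_setC ?qY ?subee//; exact: measurable_Ylab.
split; last first.
  split=> [a y am _|y a a' _ am am']; first exact: PredE.
  by rewrite !PredE.
(* Distributing $\frac12$ over the extended-real sum uses $W_1\ge0$, which holds for [a] in range
   because $W_1$ is the cost of [gam a]; [big_seq] records that range. *)
rewrite big_seq [in RHS]big_seq ge0_sume_distrr.
  by apply: eq_bigr => a; rewrite mem_index_iota ltnS => /ErrE.
move=> a; rewrite mem_index_iota ltnS => am.
have [_ <-] := gam_opt a am.
by apply: integral_ge0 => z _; rewrite lee_fin l1dist_ge0.
Qed.
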